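(* The set $P^+$ of Borel probability measures on $\mathbb{R}$ supported in $[0,\infty)$ is not good.
   Context: $P(\mathbb{R})$ denotes the set of Borel probability measures on $\mathbb{R}$, with the $\sigma$-algebra generated by the maps $\mu\mapsto\mu(B)$, $B\subset\mathbb{R}$ Borel; $P(P(\mathbb{R}))$ is the set of probability measures on $P(\mathbb{R})$. For $\Theta\in P(P(\mathbb{R}))$, a sequence $X=(X_j)_{j\in\mathbb{N}}$ of real random variables is iid-$\Theta$ if $\mathbb{P}(X\in B)=\int\theta^{\mathbb{N}}(B)\,d\Theta(\theta)$ for all Borel $B\subset\mathbb{R}^{\mathbb{N}}$, where $\theta^{\mathbb{N}}$ is the infinite product measure. A measurable set $L\subset P(\mathbb{R})$ is called good if the following holds: whenever $\Theta_1,\Theta_2\in P(P(\mathbb{R}))$ are concentrated on $L$, $X$ is iid-$\Theta_1$, $Y$ is iid-$\Theta_2$, and $\sum_{j=1}^n X_j$ and $\sum_{j=1}^n Y_j$ have the same distribution for every $n\ge 1$, then $\Theta_1=\Theta_2$. *)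

(* Defs.v *)
From HB Require Import structures.
From mathcomp Require Import all_boot all_order all_algebra.
From mathcomp Require Import all_classical all_reals ereal topology normedtype.
From mathcomp Require Import sequences measure lebesgue_measure.
From mathcomp Require Import lebesgue_integral probability.

Set Implicit Arguments.
Unset Strict Implicit.
Unset Printing Implicit Defensive.

Import Order.TTheory GRing.Theory Num.Theory.
Import numFieldNormedType.Exports.

Local Open Scope classical_set_scope.
Local Open Scope ring_scope.
Local Open Scope ereal_scope.

(* The sigma-algebra of [pprobability] is generated by the sets
   {mu | mu B < r}, B measurable and r in [0, 1]; since 0 <= mu B <= 1, this is
   the sigma-algebra generated by the evaluation maps mu |-> mu B. *)
Notation probR R := (pprobability (measurableTypeR R) R).

Definition borel_seq (R : realType) : set (set {ptws nat -> R}) :=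
  [set A | open A].

Notation seqR R := (g_sigma_algebraType (@borel_seq R)).

(* Elements of [probability T R] are functions on all subsets of T, with
   unspecified values on non-measurable sets; two of them are the same measure
   when they agree on the sigma-algebra. *)
Definition same_measure d (T : measurableType d) (R : realType)
    (mu nu : set T -> \bar R) : Prop :=
  forall A, measurable A -> mu A = nu A.

(* Finite-dimensional cylinders are a pi-system generating the Borel sets of
   R^N, so Q is determined by theta. *)
Definition is_infinite_product (R : realType) (theta : probR R)
    (Q : probability (seqR R) R) : Prop :=
  forall (n : nat) (B : nat -> set (measurableTypeR R)),
    (forall j, measurable (B j)) ->
    Q [set x | forall j, (j < n)%N -> B j (x j)] = \prod_(j < n) theta (B j).

(* [prodN theta] is the infinite product theta^N. It is unique as a measure, so
   the existential quantifier only names it. *)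
Definition iid_mixture (R : realType) (Theta : probability (probR R) R)
    d (T : measurableType d) (P : probability T R)
    (X : nat -> {RV P >-> measurableTypeR R}) : Prop :=
  exists2 prodN : probR R -> probability (seqR R) R,
    forall theta, is_infinite_product theta (prodN theta) &
    forall B : set (seqR R), measurable B ->
      P [set w | B (fun j => X j w)] = \int[Theta]_theta prodN theta B.

Definition concentrated_on (R : realType) (Theta : probability (probR R) R)
    (L : set (probR R)) : Prop :=
  Theta L = 1.

Definition partial_sum (R : realType) d (T : measurableType d)
    (P : probability T R) (X : nat -> {RV P >-> measurableTypeR R}) (n : nat)
    : T -> measurableTypeR R :=
  fun w => (\sum_(j < n) (X j w : R))%R.

(* To be used for measurable L only. Measurability is a prerequisite and not a
   conjunct, so that a failure of measurability cannot be the reason for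
   [~ good L]. X and Y may live on different probability spaces. *)
Definition good (R : realType) (L : set (probR R)) : Prop :=
  forall Theta1 Theta2 : probability (probR R) R,
    concentrated_on Theta1 L -> concentrated_on Theta2 L ->
  forall d1 (T1 : measurableType d1) (P1 : probability T1 R)
         (X : nat -> {RV P1 >-> measurableTypeR R})
         d2 (T2 : measurableType d2) (P2 : probability T2 R)
         (Y : nat -> {RV P2 >-> measurableTypeR R}),
    iid_mixture Theta1 X -> iid_mixture Theta2 Y ->
    (forall n, (1 <= n)%N ->
       same_measure (pushforward P1 (partial_sum X n))
                    (pushforward P2 (partial_sum Y n))) ->
  same_measure Theta1 Theta2.

Definition Pplus (R : realType) : set (probR R) :=
  [set theta : probR R | theta [set x : R | (0 <= x)%R] = 1].

Lemma measurable_Pplus (R : realType) : measurable (@Pplus R).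
Proof.
have mI : measurable ([set x : R | (0 <= x)%R] : set (measurableTypeR R)).
  rewrite (_ : [set x | _] = [set` `[0%R, +oo[]); first exact: measurable_itv.
  by apply/seteqP; split=> x /=; rewrite in_itv/= andbT.
have -> : @Pplus R = ~` (mset ([set x : R | (0 <= x)%R] : set (measurableTypeR R)) 1%R).
  apply/seteqP; split => theta; rewrite /Pplus /mset/=.
    by move=> ->; rewrite ltxx.
  move/negP; rewrite -leNgt => h.
  by apply/eqP; rewrite eq_le h andbT; exact: probability_le1.
apply: measurableC; apply: sub_sigma_algebra.
exists 1%R; first by rewrite /= in_itv/= ler01 lexx.
by exists [set x : R | (0 <= x)%R].
Qed.

(* Main.v *)
(* A law theta on {0, 1, 2, 3} has a generating function G_theta(x), and the sums
   of an iid-Theta sequence have at time n the generating function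
   E_Theta[G_theta(x)^n]. So two mixtures give the same sums as soon as, for each
   fixed x, the numbers G_theta(x) have the same distribution under both; no
   agreement across different x is needed. For a uniform angle u put
     G_u(x) = (1 + x + x^2 + x^3) / 4 + (1 - x) / 20 * Re (e^(-i u) p(x)),
   p being a complex polynomial of degree 2. Rotating u shows that, for real x,
   the distribution of G_u(x) depends on p(x) only through |p(x)|. The polynomials
   (x + i) (x + 2 i) and (x - i) (x + 2 i) have the same modulus on the real line,
   but they give different laws for the random measure theta_u.

   To have iid-Theta sequences at all, one needs an iid sequence of uniform
   variables, to which the quantile function of the random theta is applied. Such
   a sequence is f, f o g, f o g o g, ... where (f, g) maps the uniform law on
   [0, 1] to the uniform law on [0, 1]^2. *)

From HB Require Import structures.
Require Import Defs.
From mathcomp Require Import all_boot all_order all_algebra.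
From mathcomp Require Import all_classical all_reals ereal topology normedtype.
From mathcomp Require Import sequences measure lebesgue_measure.
From mathcomp Require Import lebesgue_integral probability.
From mathcomp Require Import numfun measurable_realfun derive realfun ftc.
From mathcomp Require Import trigo kernel.
From mathcomp Require Import ring lra.

Set Implicit Arguments.
Unset Strict Implicit.
Unset Printing Implicit Defensive.

Import Order.TTheory GRing.Theory Num.Theory.
Import numFieldNormedType.Exports.

Local Open Scope classical_set_scope.
Local Open Scope ring_scope.

(** * Moments of trigonometric functions *)

Section trigonometric_moments.
Context {R : realType}.
Implicit Types (f g : R -> R) (a b c d : R).

Let mu := @lebesgue_measure R.
Let T : R := pi *+ 2.
Let period : set (measurableTypeR R) := `[0, T].

Let T_gt0 : 0 < T. Proof. by rewrite /T mulrn_wgt0// pi_gt0. Qed.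

Lemma continuous_period_integrable f : continuous f ->
  mu.-integrable period (EFin \o f).
Proof.
move=> cf; apply: (@continuous_compact_integrable R f).
  exact: segment_compact.
exact: continuous_subspaceT.
Qed.

Definition trigf a b (u : R) : R := a * cos u + b * sin u.

Lemma is_derive_trigf a b (u : R) : is_derive u 1 (trigf a b) (trigf b (- a) u).
Proof.
rewrite /trigf; apply: is_derive_eq => /=.
by rewrite /GRing.scale/=; ring.
Qed.

Lemma continuous_trigf a b : continuous (trigf a b).
Proof.
move=> u; apply: differentiable_continuous.
by apply/derivable1_diffP; apply: ex_derive; exact: is_derive_trigf.
Qed.

Lemma continuous_trigfX a b m : continuous (fun u => trigf a b u ^+ m).
Proof.
move=> u; apply: (@continuous_comp _ _ _ (trigf a b) (fun x => x ^+ m)).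
  exact: continuous_trigf.
exact: exprn_continuous.
Qed.

Lemma periodic_Rintegral0 f (F : R -> R) : continuous f ->
  (forall u : R, is_derive u 1 F (f u)) -> F T = F 0 ->
  \int[mu]_(u in period) f u = 0.
Proof.
move=> cf dF FT; rewrite /Rintegral (@continuous_FTC2 R f F)//.
- by rewrite FT subee.
- exact: continuous_subspaceT.
- have cF u : {for u, continuous F}.
    apply: differentiable_continuous; apply/derivable1_diffP.
    by apply: ex_derive; exact: dF.
  split.
  + by move=> u _; apply: ex_derive; exact: dF.
  + exact/cvg_at_right_filter/cF.
  + exact/cvg_at_left_filter/cF.
- by move=> u _; rewrite derive1E; apply: derive_val; exact: dF.
Qed.

Lemma Rintegral_period_sum (I : Type) (s : seq I) (P : pred I)
    (f : I -> R -> R) :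
  (forall i, continuous (f i)) ->
  \int[mu]_(u in period) (\sum_(i <- s | P i) f i u) =
  \sum_(i <- s | P i) \int[mu]_(u in period) f i u.
Proof.
move=> cf; rewrite /Rintegral.
under eq_integral do rewrite -sumEFin.
have fi i : mu.-integrable period (EFin \o f i).
  exact: continuous_period_integrable.
have mT : measurable period by exact: measurable_itv.
rewrite (integral_sum mT fi)/= -sum_fine// => i _.
by apply: integrable_fin_num => //; exact: fi.
Qed.

Definition trig_moment a b m := \int[mu]_(u in period) (trigf a b u ^+ m).

Let trigf_period a b : trigf a b T = trigf a b 0.
Proof. by rewrite /trigf /T cos2pi sin2pi cos0 sin0. Qed.

Lemma trig_moment1 a b : trig_moment a b 1 = 0.
Proof.
(* The primitive comes from the derivative rule of [trigf], with [b] read as [- - b]. *)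
apply: (@periodic_Rintegral0 _ (trigf (- b) a)).
- exact: continuous_trigfX.
- by move=> u; rewrite expr1 -{2}(opprK b); exact: is_derive_trigf.
- exact: trigf_period.
Qed.

(* With [s = a cos + b sin] one has [s' ^ 2 + s ^ 2 = a ^ 2 + b ^ 2], so that
   [(s ^ m.+1 s')' = m.+1 (a ^ 2 + b ^ 2) s ^ m - m.+2 s ^ m.+2]. *)
Lemma trig_momentSS a b m :
  m.+2%:R * trig_moment a b m.+2 =
  m.+1%:R * (a ^+ 2 + b ^+ 2) * trig_moment a b m.
Proof.
have c m' : continuous (fun u => trigf a b u ^+ m').
  exact: continuous_trigfX.
have cZ r m' : continuous (fun u => r * trigf a b u ^+ m').
  by move=> u; apply: cvgM; [exact: cvg_cst|exact: c].
apply/eqP; rewrite -subr_eq0 -opprB oppr_eq0; apply/eqP.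
have mT : measurable period by exact: measurable_itv.
rewrite -!RintegralZl//; do ?exact: continuous_period_integrable.
rewrite -RintegralB//; do ?exact: continuous_period_integrable.
apply: (@periodic_Rintegral0 _
  (fun u => trigf a b u ^+ m.+1 * trigf b (- a) u)).
- by move=> u; apply: cvgB; exact: cZ.
- move=> u.
  have d1 := is_derive_trigf a b u.
  have d2 := is_derive_trigf b (- a) u.
  have d3 := is_deriveM (is_deriveX m.+1 d1) d2.
  rewrite (_ : (fun _ => _) = trigf a b ^+ m.+1 * trigf b (- a)); last first.
    by apply/funext => v; rewrite fctE exprfctE.
  apply: (is_derive_eq d3).
  (* Inserting this factor 1 makes the goal a polynomial identity in [cos u] and [sin u]. *)
  have -> : a ^+ 2 + b ^+ 2 = (a ^+ 2 + b ^+ 2) * (cos u ^+ 2 + sin u ^+ 2).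
    by rewrite cos2Dsin2 mulr1.
  rewrite exprfctE /GRing.scale/= /trigf -!natr1 !exprS.
  by ring.
- by rewrite !trigf_period.
Qed.

(** The recurrence of [trig_momentSS] sees [a] and [b] only through [a ^+ 2 + b ^+ 2], and the
    moments of order 0 and 1 do not depend on them. This takes the place of a rotation of the
    angle. *)
Lemma eq_trig_moment a b c d m : a ^+ 2 + b ^+ 2 = c ^+ 2 + d ^+ 2 ->
  trig_moment a b m = trig_moment c d m.
Proof.
move=> abcd; have [k] := ubnP m; elim: k m => // k IH [|[|m]] mk.
- by apply: eq_Rintegral => u _; rewrite !expr0.
- by rewrite !trig_moment1.
- apply: (@mulfI _ (m.+2%:R : R)); first by rewrite pnatr_eq0.
  by rewrite !trig_momentSS abcd IH// -ltnS ltnW.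
Qed.

Lemma eq_Rintegral_trigX a b c d e m : a ^+ 2 + b ^+ 2 = c ^+ 2 + d ^+ 2 ->
  \int[mu]_(u in period) ((e + trigf a b u) ^+ m) =
  \int[mu]_(u in period) ((e + trigf c d u) ^+ m).
Proof.
move=> abcd.
have E a' b' : \int[mu]_(u in period) ((e + trigf a' b' u) ^+ m) =
    \sum_(i < m.+1) e ^+ (m - i) *+ 'C(m, i) * trig_moment a' b' i.
  under eq_Rintegral.
    move=> u _; rewrite exprDn.
    under eq_bigr do rewrite -mulrnAl.
    over.
  rewrite Rintegral_period_sum; last first.
    by move=> i u; apply: cvgM; [exact: cvg_cst|exact: continuous_trigfX].
  apply: eq_bigr => i _; rewrite RintegralZl//; first exact: measurable_itv.
  apply: continuous_period_integrable.
  exact: continuous_trigfX.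
by rewrite !E; apply: eq_bigr => i _; rewrite (eq_trig_moment _ abcd).
Qed.

End trigonometric_moments.

(** * Quantile functions *)

Section uniform01.
Context {R : realType}.

Definition unif01 : probability (measurableTypeR R) R :=
  uniform_prob (@ltr01 R).

(** The open interval keeps away from the endpoints 0 and 1, where [quantile] has its default
    value. *)
Lemma uniform_probE (a b : R) (ab : a < b) (A : set (measurableTypeR R)) :
  measurable A ->
  uniform_prob ab A = ((b - a)^-1%:E * lebesgue_measure (A `&` `]a, b[))%E.
Proof.
move=> mA; rewrite -[A in LHS]setIT -integral_indic//.
have m1 D : measurable_fun (D : set (measurableTypeR R))
    (fun x => (\1_A x)%:E : \bar R).
  exact/measurable_EFinP/measurable_indic.
rewrite integral_uniform// integral_itv_bndoo; last exact: m1.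
by rewrite integral_indic.
Qed.

Lemma unif01E (A : set (measurableTypeR R)) : measurable A ->
  unif01 A = lebesgue_measure (A `&` `]0, 1[).
Proof. by move=> mA; rewrite [LHS]uniform_probE// subr0 invr1 mul1e. Qed.

End uniform01.

(** The identity of [probR R] is a probability kernel, and kernels are measurable in their
    parameter. *)
Lemma measurable_probR_eval {R : realType} (A : set (measurableTypeR R)) :
  measurable A -> measurable_fun [set: probR R] (fun t => t A).
Proof.
move=> mA.
exact: (measurable_kernel (kprobability (@measurable_id _ (probR R) setT))).
Qed.

Section quantile.
Context {R : realType}.
Implicit Types (P Q : probability (measurableTypeR R) R) (v x : R).

Lemma probability_eq_itvoy P Q :
  (forall x, P `]x, +oo[%classic = Q `]x, +oo[%classic) ->
  forall A, measurable A -> P A = Q A.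
Proof.
move=> PQ.
apply: (@measure_unique _ R (measurableTypeR R) (@RGenOInfty.G R)
  (fun k => `]- k%:R, +oo[%classic)).
- exact: RGenOInfty.measurableE.
- move=> _ _ [x ->] [y ->]; exists (Num.max x y).
  apply/seteqP; split => z /=; rewrite !in_itv/= !andbT gt_max.
    by move=> [-> ->].
  by move=> /andP.
- by move=> k; exists (- k%:R).
- rewrite -subTset => x _; exists (Num.bound `|x|) => //=.
  rewrite in_itv/= andbT ltrNl (le_lt_trans _ (archi_boundP (normr_ge0 x)))//.
  by rewrite -normrN ler_norm.
- by move=> _ [x ->]; exact: PQ.
- move=> k; rewrite (le_lt_trans (probability_le1 _ _)) ?ltry//.
Qed.

(* Outside of [0 < v < 1] the infimum is not the one of a nonempty set that is
   bounded below; the value [0] there is arbitrary. *)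
Definition quantile P v : R :=
  if 0 < v < 1 then inf [set x | (v%:E <= P `]-oo, x]%classic)%E] else 0.

(** As a random variable under [P], the identity has [cdf] equal to [P] on left rays, which gives
    the limits and the right continuity used below. *)
#[local] HB.instance Definition _ :=
  @isMeasurableFun.Build _ _ (measurableTypeR R) R
    (idfun : measurableTypeR R -> R)
    (@measurable_id _ _ setT).

Let idTR : {mfun measurableTypeR R >-> R} := idfun.

(** The infimum is attained because the distribution function is right-continuous; so [quantile P]
    is adjoint to it. *)
Lemma quantile_le P v x : 0 < v < 1 ->
  (quantile P v <= x) = (v%:E <= P `]-oo, x]%classic)%E.
Proof.
move=> v01; rewrite /quantile v01; set S := [set y | _].
have /andP[v0 v1] := v01.
pose F : R -> \bar R := cdf (idTR : {RV P >-> R}).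
have FE y : F y = P `]-oo, y]%classic by [].
have Ffin y : F y \is a fin_num by rewrite FE fin_num_measure.
have S0 : S !=set0.
  have := cvgr_gt _ (fine_cvg (cvg_cdfy1 (idTR : {RV P >-> R}))) _ v1.
  move=> [M [_ HM]]; exists (M + 1).
  by rewrite /S /= -FE -(fineK (Ffin _)) lee_fin ltW// HM// ltrDl.
have Slb : has_lbound S.
  have := cvgr_lt _ (fine_cvg (cvg_cdfNy0 (idTR : {RV P >-> R}))) _ v0.
  move=> [M [_ HM]]; exists M => y; rewrite /S/= -FE -(fineK (Ffin _)) lee_fin.
  by rewrite leNgt [in X in _ -> X]leNgt; apply: contra => /HM.
have Sup y z : S y -> y <= z -> S z.
  rewrite /S/= => Sy yz; apply: (le_trans Sy); rewrite -!FE.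
  exact: cdf_nondecreasing.
apply/idP/idP; last by move=> vx; exact: ge_inf.
move=> infx; suff : S (inf S) by move=> /Sup /(_ infx).
rewrite /S/= -FE.
have Frc : F y @[y --> (inf S)^'+] --> F (inf S).
  exact: (cdf_right_continuous (X := idTR : {RV P >-> R})).
apply: (cvge_ge _ Frc).
near=> y; rewrite FE.
have yS : 0 < y - inf S by rewrite subr_gt0.
have [z Sz zy] := inf_adherent yS (conj S0 Slb); rewrite addrC subrK in zy.
by apply: Sup Sz _; exact: ltW.
Unshelve. all: by end_near. Qed.

(** Joint measurability is what allows the quantile function of a random measure to be applied to a
    random level. *)
Lemma measurable_quantile :
  measurable_fun [set: probR R * measurableTypeR R]
    (fun p => quantile p.1 p.2 : measurableTypeR R).
Proof.
apply: (measurability _ (RGenOInfty.measurableE R)) => _ /= [_ [x ->] <-].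
rewrite setTI.
pose v01 := [set p : probR R * measurableTypeR R | 0 < p.2 < 1].
(* For levels outside of []0, 1[] the value is 0, so there the condition reduces to the sign of
   [x]. *)
rewrite (_ : _ @^-1` _ =
   (v01 `&` [set p : probR R * measurableTypeR R |
     (p.1 `]-oo, x]%classic < (p.2 : R)%:E)%E]) `|`
   (~` v01 `&` [set p | (x < 0)%R])); last first.
  apply/seteqP; split => p /=; rewrite in_itv/= andbT.
    have [p01|p01] := boolP (0 < p.2 < 1).
      by rewrite ltNge quantile_le// -ltNge => Pp; left.
    by rewrite /quantile (negbTE p01) => x0; right; split => //; exact/negP.
  move=> [[p01 Pp]|[/negP p01]].
    by rewrite ltNge quantile_le// -ltNge.
  by rewrite /quantile (negbTE p01).
have mv : measurable v01.
  rewrite (_ : v01 = setT `&` snd @^-1` `]0, 1[%classic).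
    by apply: measurable_snd => //; exact: measurable_itv.
  by rewrite setTI; apply/seteqP; split => p /=; rewrite in_itv.
apply: measurableU; last first.
  apply: measurableI; first exact: measurableC.
  by case: (ltP x 0) => x0;
    [rewrite (_ : mkset _ = setT)|rewrite (_ : mkset _ = set0)] => //;
    apply/seteqP; split.
apply: measurableI => //; rewrite -[X in measurable X]setTI.
apply: measurable_lte => //.
  by apply: (measurableT_comp (measurable_probR_eval _) measurable_fst).
by apply/measurable_EFinP; exact: measurable_snd.
Qed.

Lemma measurable_quantileP P :
  measurable_fun setT (quantile P : measurableTypeR R -> measurableTypeR R).
Proof.
apply: (@measurableT_comp _ _ _ _ _ _ _ _ (fun v => (P : probR R, v))
  measurable_quantile).
by apply: measurable_fun_pair; [exact: measurable_cst|exact: measurable_id].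
Qed.

(** Inverse transform sampling: by [quantile_le], the quantile exceeds [x] exactly for levels [v]
    above the mass of the left ray at [x]. *)
Lemma unif01_quantile P (A : set (measurableTypeR R)) : measurable A ->
  unif01 (quantile P @^-1` A) = P A.
Proof.
have mq := measurable_quantileP P.
pose q : {mfun measurableTypeR R >-> measurableTypeR R} :=
  HB.pack (quantile P : measurableTypeR R -> measurableTypeR R)
    (isMeasurableFun.Build _ _ _ _ _ mq).
apply: (@probability_eq_itvoy (distribution unif01 q) P) => x.
rewrite [LHS](unif01E (A := q @^-1` _)); last first.
  by rewrite -[X in measurable X]setTI; apply: (mq) => //; exact: measurable_itv.
have Px : P `]-oo, x]%classic \is a fin_num by rewrite fin_num_measure.
have -> : (q @^-1` `]x, +oo[%classic) `&` `]0, 1[ =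
    `](fine (P `]-oo, x]%classic)), 1[%classic.
  apply/seteqP; split => v /=; rewrite !in_itv/= andbT.
    move=> [+ v01]; rewrite ltNge quantile_le// -ltNge -(fineK Px) lte_fin => ->.
    by have /andP[] := v01.
  move=> /andP[Pv v1].
  have v01 : 0 < v < 1 by rewrite v1 andbT (le_lt_trans _ Pv)// fine_ge0.
  by rewrite v01 ltNge quantile_le// -ltNge -(fineK Px) lte_fin Pv.
rewrite lebesgue_measure_itv/= -[in RHS]setCitvl probability_setC// -(fineK Px).
(* The length formula tests whether the interval is nonempty. If it is not, the left ray has mass 1
   and both sides vanish. *)
rewrite !lte_fin; case: ltP => // P1.
have : (P `]-oo, x]%classic <= 1)%E by exact: probability_le1.
rewrite -(fineK Px) !lee_fin /= => P2.
have -> : fine (P `]-oo, x]%classic) = 1 by apply/eqP; rewrite eq_le P1 P2.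
by rewrite subee.
Qed.

End quantile.

(** * Independent uniform variables *)

Section digits.
Context {R : realType}.
Implicit Types (B z : R) (b : nat -> bool).

(** Digits are boolean in every base: base 2 gives binary expansions on [[0, 1]], with all digits of
    1 equal to 1, while base 3 serves only for numbers without digit 2. *)
Definition digit B z : bool := 1 <= B * z.

Definition digit_shift B z : R := B * z - (digit B z)%:R.

Definition digits B z (k : nat) : bool := digit B (iter k (digit_shift B) z).

Definition undigits B b : R :=
  limn (series (fun k => (b k)%:R * B^-1 ^+ k.+1)).

Lemma digitsS B z k : digits B z k.+1 = digits B (digit_shift B z) k.
Proof. by rewrite /digits iterSr. Qed.

Lemma is_cvg_undigits B b : 1 < B ->
  cvgn (series (fun k => (b k)%:R * B^-1 ^+ k.+1)).
Proof.
move=> B1; have B0 : 0 < B by exact: lt_trans B1.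
apply: (@series_le_cvg _ _ (geometric B^-1 B^-1)).
- by move=> k; rewrite mulr_ge0// exprn_ge0// invr_ge0 ltW.
- by move=> k; rewrite /= mulr_ge0// ?exprn_ge0// invr_ge0 ltW.
- move=> k; rewrite /= -exprS ler_piMl ?exprn_ge0 ?invr_ge0 ?(ltW B0)//.
  by case: (b k).
- by apply: is_cvg_geometric_series; rewrite gtr0_norm ?invr_gt0// invf_lt1.
Qed.

Lemma undigitsS B b : 1 < B ->
  undigits B b = B^-1 * ((b 0)%:R + undigits B (fun k => b k.+1)).
Proof.
move=> B1; apply/cvg_lim => //; rewrite -cvg_shiftS.
rewrite [X in X @ _](_ : _ = (fun n => B^-1 *
  ((b 0)%:R + series (fun k => (b k.+1)%:R * B^-1 ^+ k.+1) n))); last first.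
  apply/funext => n.
  rewrite -[LHS]/(\sum_(0 <= k < n.+1) ((b k)%:R * B^-1 ^+ k.+1)).
  rewrite /series big_nat_recl// mulrDr expr1 [X in X + _]mulrC.
  congr +%R; rewrite mulr_sumr; apply: eq_bigr => k _.
  by rewrite [RHS]mulrCA -exprS.
apply: cvgM; first exact: cvg_cst.
by apply: cvgD; [exact: cvg_cst|exact: is_cvg_undigits].
Qed.

Lemma undigits_ge0 B b : 1 < B -> 0 <= undigits B b.
Proof.
move=> B1; apply: limr_ge; first exact: is_cvg_undigits.
apply: nearW => n; apply: sumr_ge0 => k _.
by rewrite mulr_ge0// exprn_ge0// invr_ge0 ltW// (lt_trans _ B1).
Qed.

(** All digits equal to 1 would give 1/2, the sum of the geometric series. Hence a tail never
    carries into the preceding digit. *)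
Lemma undigits3_lt1 b : undigits 3 b < 1.
Proof.
apply: (@le_lt_trans _ _ 2^-1); last by lra.
apply: limr_le; first by apply: is_cvg_undigits; lra.
apply: nearW => n; rewrite /series/=.
suff : \sum_(0 <= k < n) (b k)%:R * (3 : R)^-1 ^+ k.+1 <=
    2^-1 * (1 - 3^-1 ^+ n).
  by move/le_trans; apply; rewrite ler_piMr ?invr_ge0// gerBl exprn_ge0.
elim: n => [|n IH]; first by rewrite big_geq// expr0 subrr mulr0.
rewrite big_nat_recr//= exprS.
have : (b n)%:R * ((3 : R)^-1 * 3^-1 ^+ n) <= 3^-1 * 3^-1 ^+ n.
  by rewrite ler_piMl ?mulr_ge0 ?exprn_ge0//; case: (b n).
move: IH; set s := \sum_(_ <= _ < _) _; set p := _ ^+ n.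
by lra.
Qed.

(* In base 3 the digits 0 and 1 can be read off without ambiguity. *)
Lemma undigits3K b k : digits 3 (undigits 3 b) k = b k.
Proof.
elim: k b => [|k IH] b.
  rewrite /digits/= /digit undigitsS ?mulVKf//; last by lra.
  case: (b 0); first by rewrite lerDl undigits_ge0//; lra.
  by rewrite add0r leNgt undigits3_lt1.
rewrite digitsS -[RHS](IH (fun k => b k.+1)); congr (digits _ _ _).
have u3 : 3 * undigits 3 b = (b 0)%:R + undigits 3 (fun k => b k.+1).
  by rewrite undigitsS ?mulVKf//; lra.
rewrite /digit_shift /digit u3.
have := undigits3_lt1 (fun k => b k.+1).
have : 0 <= undigits 3 (fun k => b k.+1) by rewrite undigits_ge0//; lra.
move: (undigits 3 _) => u u_ge0 u_lt1.
case: (b 0); first by rewrite lerDl u_ge0 addrAC subrr add0r.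
by rewrite add0r leNgt u_lt1 subr0.
Qed.

Lemma digits2K z : 0 <= z <= 1 -> undigits 2 (digits 2 z) = z.
Proof.
move=> z01; pose y n := iter n (digit_shift 2) z.
have y01 n : 0 <= y n <= 1.
  elim: n => // n /andP[y0 y1]; rewrite /y iterS -/(y n) /digit_shift /digit.
  by case: (leP 1 (2 * y n)) => /=; lra.
apply/cvg_lim => //.
(* The remainder after [n] digits is the [n]-th shift of [z], scaled by [2^-1 ^+ n]; it tends to 0
   since the shifts stay in [[0, 1]]. *)
have -> : series (fun k => (digits 2 z k)%:R * 2^-1 ^+ k.+1) =
    (fun n => z - 2^-1 ^+ n * y n).
  apply/funext; elim=> [|n IH].
    by rewrite /series/= big_geq// expr0 mul1r subrr.
  rewrite seriesSr IH /digits -/(y n).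
  rewrite /y iterS -/(y n) /digit_shift exprS.
  by lra.
rewrite -[X in _ --> X]subr0; apply: cvgB; first exact: cvg_cst.
apply: (@squeeze_cvgr _ _ _ _ (fun=> 0) (fun n => 2^-1 ^+ n)).
- apply: nearW => n; have /andP[y0 y1] := y01 n.
  by rewrite mulr_ge0 ?exprn_ge0//= ler_piMr// exprn_ge0.
- exact: cvg_cst.
- by apply: cvg_expr; rewrite gtr0_norm; lra.
Qed.

Lemma measurable_natr_bool d (T : measurableType d) (f : T -> bool) :
  measurable_fun [set: T] f -> measurable_fun [set: T] (fun t => (f t)%:R : R).
Proof.
move=> mf; rewrite (_ : (fun _ => _) = (fun t => if f t then 1 else 0)).
  exact: measurable_fun_ifT.
by apply/funext => t; case: (f t).
Qed.

Lemma measurable_digits B k : measurable_fun [set: measurableTypeR R]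
  (fun z : measurableTypeR R => digits B z k).
Proof.
have md : measurable_fun [set: measurableTypeR R]
    (digit B : measurableTypeR R -> bool).
  by apply: measurable_fun_ler => //; exact: measurable_funM.
have ms : measurable_fun [set: measurableTypeR R]
    (digit_shift B : measurableTypeR R -> measurableTypeR R).
  by apply: measurable_funB; [exact: measurable_funM|exact: measurable_natr_bool].
apply: (measurableT_comp md).
by elim: k => [|k IH]; [exact: measurable_id|exact: (measurableT_comp ms IH)].
Qed.

Lemma measurable_undigits d (T : measurableType d) B (b : T -> nat -> bool) :
  1 < B -> (forall k, measurable_fun [set: T] (b ^~ k)) ->
  measurable_fun [set: T] (fun t => undigits B (b t) : measurableTypeR R).
Proof.
move=> B1 mb.
apply: (@measurable_fun_cvg _ _ _ _
  (fun n t => series (fun k => (b t k)%:R * B^-1 ^+ k.+1) n)).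
- move=> n; apply: measurable_sum => k; apply: measurable_funM => //.
  exact: measurable_natr_bool.
- by move=> t _; exact: is_cvg_undigits.
Qed.

End digits.

Lemma probability_setIl d (T : measurableType d) (R : realType)
    (P : probability T R) (C X : set T) :
  measurable C -> measurable X -> P C = 1%E -> P (X `&` C) = P X.
Proof.
move=> mC mX PC.
suff XC : P (X `\` C) = 0%E by rewrite -[LHS]add0e -XC; exact/esym/measureDI.
have := probability_setC P mC; rewrite PC subee// => PC0.
apply/eqP; rewrite eq_le measure_ge0 andbT -PC0 le_measure ?inE//.
- exact: measurableD.
- exact: measurableC.
Qed.

(** * From one uniform variable to an independent sequence *)

Section iid_uniform.
Context {R : realType}.
Local Notation mR := (measurableTypeR R).
Implicit Types A B : set mR.

Lemma unif01_oo : unif01 (`]0, 1[%classic : set mR) = 1%E.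
Proof.
by rewrite unif01E// setIid lebesgue_measure_itv/= lte_fin ltr01 sube0.
Qed.

(** Binary digits of the two coordinates alternate but are written in base 3, so that decoding is
    exact even at dyadic numbers. The price is a law that is not uniform. *)
Definition interleave (p : mR * mR) : mR :=
  undigits 3 (fun k => digits 2 (if odd k then p.2 else p.1) k./2).

Definition deinterleave (r : nat) (z : mR) : mR :=
  undigits 2 (fun k => digits 3 z (r + k.*2)).

Lemma measurable_interleave : measurable_fun [set: mR * mR] interleave.
Proof.
apply: measurable_undigits => [|k]; first by lra.
case: (odd k).
- exact: (measurableT_comp (@measurable_digits R 2 k./2) measurable_snd).
- exact: (measurableT_comp (@measurable_digits R 2 k./2) measurable_fst).
Qed.

Lemma measurable_deinterleave r : measurable_fun [set: mR] (deinterleave r).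
Proof.
by apply: measurable_undigits => [|k]; [lra|exact: measurable_digits].
Qed.

Lemma interleaveK0 p : 0 <= p.1 <= 1 -> deinterleave 0 (interleave p) = p.1.
Proof.
move=> p01; rewrite -[RHS]digits2K//; congr (undigits 2 _).
by apply/funext => k; rewrite undigits3K add0n odd_double doubleK.
Qed.

Lemma interleaveK1 p : 0 <= p.2 <= 1 -> deinterleave 1 (interleave p) = p.2.
Proof.
move=> p01; rewrite -[RHS]digits2K//; congr (undigits 2 _).
by apply/funext => k; rewrite undigits3K add1n/= odd_double/= uphalf_double.
Qed.

(* The law of [interleave] is the image of the uniform law by its quantile
   function, which turns one uniform variable into two independent ones. *)
Lemma unif01_split : exists f g : mR -> mR,
  [/\ measurable_fun setT f, measurable_fun setT g &
      forall A B, measurable A -> measurable B ->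
        unif01 (f @^-1` A `&` g @^-1` B) = (unif01 A * unif01 B)%E].
Proof.
pose E : {mfun (mR * mR)%type >-> mR} := HB.pack interleave
  (isMeasurableFun.Build _ _ _ _ _ measurable_interleave).
pose U2 : probability (mR * mR)%type R := (unif01 \x unif01)%E.
pose mu : probability mR R := distribution U2 E.
exists (deinterleave 0 \o quantile mu), (deinterleave 1 \o quantile mu).
have mq := measurable_quantileP mu.
have md := measurable_deinterleave.
split.
- exact: (measurableT_comp (md 0) mq).
- exact: (measurableT_comp (md 1) mq).
move=> A B mA mB.
pose D : set mR := deinterleave 0 @^-1` A `&` deinterleave 1 @^-1` B.
have mD : measurable D.
  by apply: measurableI; rewrite -[X in measurable X]setTI; apply: md.
transitivity (unif01 (quantile mu @^-1` D)); first by [].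
rewrite unif01_quantile//.
pose I1 : set mR := `]0, 1[%classic.
pose I2 : set (mR * mR) := I1 `*` I1.
have mI2 : measurable I2 by apply: measurableX; exact: measurable_itv.
have U2I2 : U2 I2 = 1%E.
  transitivity (unif01 I1 * unif01 I1)%E.
    by apply: product_measure1E; exact: measurable_itv.
  by rewrite unif01_oo mule1.
transitivity (U2 (E @^-1` D)); first by [].
(* Decoding inverts [interleave] only for coordinates in [[0, 1]], so both events are cut down to
   the open unit square, which has full measure. *)
rewrite -(probability_setIl mI2 _ U2I2)//; last exact: measurable_funPTI.
have mAB : measurable (A `*` B) by exact: measurableX.
transitivity (U2 (A `*` B)); last exact: product_measure1E.
rewrite -[RHS](probability_setIl mI2 mAB U2I2).
congr (U2 _); apply/seteqP; split => -[x y] [xy [/=]].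
all: rewrite /I1/= !in_itv/= => x01 y01.
all: have [x1 y1] : 0 <= x <= 1 /\ 0 <= y <= 1 by split; lra.
all: move: xy.
all: rewrite /D /preimage/= (@interleaveK0 (x, y))// (@interleaveK1 (x, y))//.
all: by split => //; rewrite /I2/I1/= !in_itv.
Qed.

(** All variables after the first are the same sequence evaluated at [g v], so [unif01_split] peels
    off the first factor and induction treats the shifted sets. *)
Lemma iid_unif01 : exists V : nat -> mR -> mR,
  (forall j, measurable_fun setT (V j)) /\
  forall n (B : nat -> set mR), (forall j, measurable (B j)) ->
    unif01 [set v | forall j, (j < n)%N -> B j (V j v)] =
    (\prod_(j < n) unif01 (B j))%E.
Proof.
have [f [g [mf mg fgE]]] := unif01_split.
exists (fun j => f \o iter j g).
have mi j : measurable_fun setT (iter j g : mR -> mR).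
  by elim: j => [|j IH]; [exact: measurable_id|exact: (measurableT_comp mg IH)].
have mV j : measurable_fun setT (f \o iter j g).
  exact: (measurableT_comp mf (mi j)).
split=> // n; elim: n => [|n IH] B mB.
  rewrite big_ord0 -[RHS](probability_setT unif01); congr (unif01 _).
  by apply/seteqP; split.
rewrite big_ord_recl -(IH (fun j => B j.+1))// -fgE//; last first.
  rewrite (_ : mkset _ = \bigcap_(j in [set j | (j < n)%N])
    ((f \o iter j g) @^-1` B j.+1)).
    apply: bigcap_measurableType => // j _.
    by rewrite -[X in measurable X]setTI; apply: mV.
  by apply/seteqP; split.
congr (unif01 _); apply/seteqP; split => v /=.
  move=> H; split; first exact: (H 0).
  by move=> j jn; have := H j.+1 jn; rewrite /= -iterSr.
move=> [H0 H] [|j] // jn; rewrite iterSr; exact: H.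
Qed.

End iid_uniform.

(** * Mixtures of infinite products *)

Section sequence_space.
Context {R : realType}.
Local Notation mR := (measurableTypeR R).

Lemma measurable_seqR_proj j : measurable_fun [set: seqR R] (fun x => x j : mR).
Proof.
apply: (measurability _ (RGenOpens.measurableE R)) => _ /= [_ [a [b ->]] <-].
rewrite setTI; apply: sub_sigma_algebra; rewrite /borel_seq /=.
apply: (@open_comp {ptws nat -> R} R (fun x => x j)); last exact: interval_open.
by move=> x _; exact: (@proj_continuous nat (fun=> R) j x).
Qed.

(** The length of [s] is the number of constrained coordinates; lists of rational pairs form a
    countable index set. *)
Let rbox (s : seq (rat * rat)) : set (nat -> R) :=
  [set x | forall i, (i < size s)%N ->
    ratr (nth (0, 0) s i).1 < x i < ratr (nth (0, 0) s i).2].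

(** If no box around [x] fits into [A], then for every [n] some point outside [A] is
    [n.+1%:R^-1]-close to [x] in the first [n] coordinates. These points converge pointwise to [x],
    against openness. *)
Let open_rbox (A : set {ptws nat -> R}) : open A ->
  A = \bigcup_(s in [set s | rbox s `<=` A]) rbox s.
Proof.
move=> oA; apply/seteqP; split => x; last by move=> [s sA xs]; exact: sA.
move=> Ax; apply: contrapT => nx.
have Hy n : {y : nat -> R | ~ A y &
    forall i, (i < n)%N -> `|x i - y i| < n.+1%:R^-1}.
  apply: cid2; apply: contrapT => nyA; apply: nx.
  have q1 i : {q : rat | x i - n.+1%:R^-1 < ratr q < x i}.
    apply: cid; have := @rat_in_itvoo R (x i - n.+1%:R^-1) (x i).
    by move=> /(_ _)[|q]; rewrite ?gtrBl ?invr_gt0// in_itv; exists q.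
  have q2 i : {q : rat | x i < ratr q < x i + n.+1%:R^-1}.
    apply: cid; have := @rat_in_itvoo R (x i) (x i + n.+1%:R^-1).
    by move=> /(_ _)[|q]; rewrite ?ltrDl ?invr_gt0// in_itv; exists q.
  exists (mkseq (fun i => (sval (q1 i), sval (q2 i))) n).
    move=> y; rewrite /rbox/= size_mkseq => ys.
    apply: contrapT => nAy; apply: nyA; exists y => // i i_n.
    have := ys _ i_n; rewrite nth_mkseq//=.
    case: (q1 i) => /= a /andP[a1 a2]; case: (q2 i) => /= b /andP[b1 b2].
    move: (n.+1%:R^-1 : R) a1 b2 => e a1 b2 /andP[ay yb]; rewrite ltr_norml.
    by apply/andP; split; lra.
  move=> i; rewrite size_mkseq => i_n; rewrite nth_mkseq//=.
  case: (q1 i) => /= a /andP[a1 a2]; case: (q2 i) => /= b /andP[b1 b2].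
  by rewrite a2 b1.
pose y n := s2val (Hy n).
have yx : {ptws, y @ \oo --> (x : nat -> R)}.
  apply/pointwise_cvgP => i.
  suff : (fun n => y n i) @ \oo --> x i by [].
  apply/cvgrPdist_lt => e e0; near=> n.
  have := s2valP' (Hy n) i; rewrite -/(y n) => /(_ _)/lt_trans; apply.
    by near: n; exact: nbhs_infty_gt.
  by near: n; exact: near_infty_natSinv_lt (PosNum e0).
have [N _ /(_ N (leqnn N))] : \forall n \near \oo, A (y n).
  by apply: (yx A); exact: open_nbhs_nbhs.
exact: (s2valP (Hy N)).
Unshelve. all: by end_near. Qed.

(* Open sets are countable unions of rational boxes. *)
Lemma measurable_seqR d (T : measurableType d) (F : T -> seqR R) :
  (forall j, measurable_fun [set: T] (fun t => F t j : mR)) ->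
  measurable_fun [set: T] F.
Proof.
move=> mF.
apply: (@measurability _ _ T (seqR R) setT F (@borel_seq R)) => // _ /= [A oA <-].
rewrite setTI (open_rbox oA) preimage_bigcup.
have -> : \bigcup_(s in [set s | rbox s `<=` A]) (F @^-1` rbox s) =
  \bigcup_s (if pselect (rbox s `<=` A) then F @^-1` rbox s else set0).
  apply/seteqP; split => t.
    by move=> [s /= sA ts]; exists s => //; case: pselect.
  by move=> [s _]; case: pselect => // sA ts; exists s.
apply: countable_bigcupT_measurable => [|s]; first exact: countableP.
case: pselect => sA /=; last exact: measurable0.
rewrite (_ : _ @^-1` _ = \bigcap_(i in [set i | (i < size s)%N])
  ((fun t => F t i : mR) @^-1`
      `]ratr (nth (0, 0) s i).1, ratr (nth (0, 0) s i).2[%classic)).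
  apply: bigcap_measurableType => i _; rewrite -[X in measurable X]setTI.
  by apply: mF => //; exact: measurable_itv.
by apply/seteqP; split => t /= H i /H; rewrite /= in_itv.
Qed.

End sequence_space.

(** The sample space carries [theta] and an independent uniform variable, from which [V] makes an
    iid sequence. Measurability of [prodN ^~ B] is recorded for integrating against image
    measures. *)
Lemma iid_mixture_exists {R : realType} (Theta : probability (probR R) R) :
  exists d (T : measurableType d) (P : probability T R)
    (X : nat -> {RV P >-> measurableTypeR R})
    (prodN : probR R -> probability (seqR R) R),
  [/\ forall theta, is_infinite_product theta (prodN theta),
      forall B, measurable B -> measurable_fun [set: probR R] (prodN ^~ B) &
      forall B : set (seqR R), measurable B ->
        P [set w | B (fun j => X j w)] = (\int[Theta]_theta prodN theta B)%E].
Proof.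
have [V [mV VE]] := @iid_unif01 R.
pose T : measurableType _ := (probR R * measurableTypeR R)%type.
have mX j : measurable_fun [set: T]
    (fun p : T => quantile p.1 (V j p.2) : measurableTypeR R).
  apply: (@measurableT_comp _ _ _ _ _ _ _ _ (fun p : T => (p.1, V j p.2))
    (@measurable_quantile R)).
  apply: measurable_fun_pair => //.
  exact: (measurableT_comp (mV j) measurable_snd).
pose P : probability T R := (Theta \x unif01)%E.
pose X j : {RV P >-> measurableTypeR R} := HB.pack
  (fun p : T => quantile p.1 (V j p.2) : measurableTypeR R)
  (isMeasurableFun.Build _ _ _ _ _ (mX j)).
have mW (theta : probR R) : measurable_fun [set: measurableTypeR R]
    (fun v => (fun j => quantile theta (V j v)) : seqR R).
  apply: measurable_seqR => j.
  exact: (measurableT_comp (measurable_quantileP theta) (mV j)).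
pose W theta : {mfun measurableTypeR R >-> seqR R} := HB.pack
  (fun v => (fun j => quantile theta (V j v)) : seqR R)
  (isMeasurableFun.Build _ _ _ _ _ (mW theta)).
exists _, T, P, X, (fun theta => distribution unif01 (W theta)).
(* The product measure integrates the measures of sections, and the section at [theta] is the event
   for the sequence with [theta] fixed. *)
have xsectionW (B : set (seqR R)) theta : unif01 (W theta @^-1` B) =
    unif01 (xsection [set p : T | B (fun j => X j p)] theta).
  by congr (unif01 _); apply/seteqP; split => v; rewrite /xsection /= inE; exact.
split => [theta n B mB|B mB|B mB].
-   transitivity (\prod_(j < n) unif01 (quantile theta @^-1` B j))%E.
    apply: (VE n (fun j => quantile theta @^-1` B j)) => j.
    by rewrite -[X in measurable X]setTI; exact: measurable_quantileP.
  by apply: eq_bigr => j _; exact: unif01_quantile.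
- rewrite (_ : (fun _ => _) = fun theta => unif01 (W theta @^-1` B))//.
  under eq_fun do rewrite xsectionW.
  apply: measurable_fun_xsection.
  rewrite (_ : mkset _ = (fun p : T => (fun j => X j p) : seqR R) @^-1` B)//.
  rewrite -[X in measurable X]setTI.
  by apply: (@measurable_seqR R _ T (fun p : T => (fun j => X j p) : seqR R)).
- by apply: eq_integral => theta _; exact: esym (xsectionW _ _).
Qed.

(** * Partial sums of integer-valued variables *)

Section partial_sum_law.
Context {R : realType}.
Local Notation mR := (measurableTypeR R).
Implicit Types (A : set mR) (n m : nat).

Definition sum_event n A : set (seqR R) :=
  [set x | A (\sum_(j < n) (x j : R))].

Lemma measurable_sum_event n A : measurable A -> measurable (sum_event n A).
Proof.
move=> mA; rewrite -[X in measurable X]setTI.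
have mS : measurable_fun [set: seqR R] (fun x => \sum_(j < n) (x j : R) : mR).
  by apply: measurable_sum => j; exact: measurable_seqR_proj.
exact: mS.
Qed.

Lemma sum_genfunX m (c : 'I_m -> R) n k :
  ((\sum_(i < m) c i *: 'X^i) ^+ n)`_k =
  \sum_(t : {ffun 'I_n -> 'I_m} | k == \sum_(j < n) (t j : nat))
     \prod_(j < n) c (t j).
Proof.
rewrite -[n in LHS]card_ord -prodr_const bigA_distr_bigA/= coef_sum.
rewrite [RHS]big_mkcond/=; apply: eq_bigr => t _.
rewrite (eq_bigr (fun j => (c (t j))%:P * 'X^(t j))); last first.
  by move=> j _; rewrite mul_polyC.
rewrite big_split/= prodrXr -rmorph_prod/= coefCM coefXn.
by case: eqP => _; rewrite ?mulr1 ?mulr0.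
Qed.

(** Almost surely the first [n] coordinates form one of the finitely many words [t]; grouping words
    by their sum yields the coefficients of the power. The range [(n * m).+1] is a crude bound on
    the sum. *)
Lemma sum_event_genfun m (c : 'I_m -> R) (theta : probR R)
    (Q : probability (seqR R) R) n A :
  is_infinite_product theta Q ->
  (forall i : 'I_m, theta [set (i%:R : R)] = (c i)%:E) ->
  \sum_(i < m) c i = 1 -> measurable A ->
  Q (sum_event n A) =
  (\sum_(k < (n * m).+1 | (k%:R : R) \in A)
     ((\sum_(i < m) c i *: 'X^i) ^+ n)`_k)%:E.
Proof.
move=> Qtheta thetac c1 mA.
pose cyl (t : {ffun 'I_n -> 'I_m}) : set (seqR R) :=
  [set x | forall j : 'I_n, x j = (t j)%:R].
(* [is_infinite_product] wants a set for every index, hence [setT] from [n] on. *)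
pose box (t : {ffun 'I_n -> 'I_m}) (j : nat) : set mR :=
  if insub j is Some j' then [set (t j')%:R] else setT.
have cylE t : cyl t = [set x | forall j, (j < n)%N -> box t j (x j)].
  apply/seteqP; split => x /= H j.
    by move=> jn; rewrite /box insubT; exact: (H (Ordinal jn)).
  by have := H j (ltn_ord j); rewrite /box valK.
have mset1 (r : R) : measurable ([set r] : set mR) by exact: measurable_set1.
have Qcyl t : Q (cyl t) = (\prod_(j < n) c (t j))%:E.
  rewrite cylE (Qtheta n (box t)); last first.
    by move=> j; rewrite /box; case: insub => // j'; exact: mset1.
  by rewrite -prodEFin; apply: eq_bigr => j _; rewrite /box valK thetac.
have mcyl t : measurable (cyl t).
  rewrite (_ : cyl t = \bigcap_(j : 'I_n)
      ((fun x => x j : mR) @^-1` [set (t j)%:R])).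
    apply: fin_bigcap_measurable => [|j _]; first exact: finite_finset.
    by rewrite -[X in measurable X]setTI; exact: measurable_seqR_proj.
  by apply/seteqP; split => x /= H j; [move=> _|]; apply: H.
have cyl_triv F : trivIset setT (fun t => F `&` cyl t).
  apply/trivIsetP => t t' _ _ tt'; rewrite -subset0 => x [[_ xt] [_ xt']].
  move/eqP: tt'; apply; apply/ffunP => j; apply/val_inj => /=.
  by apply/eqP; rewrite -(eqr_nat R) -xt -xt'.
have QFcyl F : measurable F ->
    Q (F `&` \bigcup_t cyl t) = (\sum_t Q (F `&` cyl t))%E.
  move=> mF; rewrite setI_bigcupr measure_fin_bigcup//.
    rewrite -[RHS]big_enum [RHS]fsbig_seq ?enum_uniq//.
    rewrite (_ : [set` _] = setT)//.
    by apply/seteqP; split => t //= _; rewrite mem_enum.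
    exact: finite_finset.
  by move=> t _; exact: measurableI.
have mU : measurable (\bigcup_t cyl t).
  by apply: fin_bigcup_measurable => //; exact: finite_finset.
(* The cylinders have total mass [(\sum_(i < m) c i) ^+ n]. *)
have QU : Q (\bigcup_t cyl t) = 1%E.
  rewrite -[\bigcup_t _]setTI QFcyl//.
  under eq_bigr do rewrite setTI Qcyl.
  rewrite sumEFin -(bigA_distr_bigA (fun _ => c)) c1.
  by rewrite prodr_const expr1n.
have mS := measurable_sum_event n mA.
rewrite -(probability_setIl mU mS QU) QFcyl//.
transitivity (\sum_(t : {ffun 'I_n -> 'I_m})
    (if ((\sum_(j < n) (t j : nat))%:R : R) \in A then
    \prod_(j < n) c (t j) else 0)%:E)%E.
  apply: eq_bigr => t _; case: ifPn => tA.
    rewrite -Qcyl setIidr// => x xt; rewrite /sum_event/=.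
    move: tA; rewrite inE natr_sum.
    by congr (A _); apply: eq_bigr => j _; rewrite xt.
  rewrite (_ : _ `&` _ = set0) ?measure0// -subset0 => x [xA xt].
  move/negP: tA; apply; rewrite inE natr_sum.
  move: xA; rewrite /sum_event/=.
  by congr (A _); apply: eq_bigr => j _; rewrite xt.
rewrite sumEFin; congr EFin.
under [RHS]eq_bigr do rewrite sum_genfunX.
rewrite (exchange_big_dep xpredT)//=; apply: eq_bigr => t _.
set N := (\sum_(j < n) _)%N.
have Nlt : (N < (n * m).+1)%N.
  rewrite ltnS -[n in (n * m)%N]card_ord -sum_nat_const; apply: leq_sum => j _.
  exact/ltnW/ltn_ord.
case: ifPn => NA.
  rewrite (big_pred1 (Ordinal Nlt))// => k /=.
  by rewrite -val_eqE/=; case: eqP => [->|]; rewrite ?NA ?andbF.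
rewrite big_pred0// => k; case: eqP => [->|]; rewrite ?andbF//.
by rewrite (negbTE NA).
Qed.

End partial_sum_law.

(** * Laws on the integers 0, ..., m - 1 *)

Section nat_law.
Context {R : realType}.
Local Notation mR := (measurableTypeR R).
Variables (m : nat) (c : nat -> {nonneg R}).

Definition nat_msum := msum (fun i => mscale (c i) (dirac (i%:R : mR))) m.

HB.instance Definition _ := Measure.on nat_msum.

Let nat_msumE (A : set mR) : nat_msum A =
  (\sum_(i < m) (c i)%:num * ((i%:R : R) \in A)%:R)%:E.
Proof.
by rewrite /nat_msum /msum -sumEFin; apply: eq_bigr => i _; rewrite EFinM -diracE.
Qed.

Hypothesis c1 : \sum_(i < m) (c i)%:num = 1.

Let nat_msum1 : nat_msum setT = 1%E.
Proof.
rewrite nat_msumE -[in RHS]c1; congr EFin.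
by apply: eq_bigr => i _; rewrite in_setT mulr1.
Qed.

Definition nat_law : probability mR R :=
  HB.pack nat_msum (Measure_isProbability.Build _ _ _ nat_msum nat_msum1).

Lemma nat_lawE (A : set mR) :
  nat_law A = (\sum_(i < m) (c i)%:num * ((i%:R : R) \in A)%:R)%:E.
Proof. exact: nat_msumE. Qed.

Lemma nat_law1 (i : 'I_m) : nat_law [set (i%:R : R)] = (c i)%:num%:E.
Proof.
have set1E (j : 'I_m) : ((j%:R : R) \in [set (i%:R : R)]) = (j == i).
  rewrite -val_eqE/= -(eqr_nat R).
  by apply/idP/eqP; [move/set_mem|move=> ji; apply/mem_set].
rewrite nat_lawE (bigD1 i)//= set1E eqxx mulr1 big1 ?addr0// => j ji.
by rewrite set1E (negbTE ji) mulr0.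
Qed.

End nat_law.

(** * The two mixtures *)

Section counterexample.
Context {R : realType}.
Local Notation mR := (measurableTypeR R).
Implicit Types (b : bool) (u x : R) (i k n : nat).

(* The coefficients of [(1 - X) (X ^ 2 - 2 e)] and of [(1 - X) (2 + e) X], for
   [e = (-1) ^ b]: the polynomials [X ^ 2 - 2 e] and [(2 + e) X] are the real and
   imaginary parts of [(X + e i) (X + 2 i)]. *)
Definition cos_coef b i : R :=
  nth 0 [:: - 2 * (-1) ^+ b; 2 * (-1) ^+ b; 1; - 1] i.

Definition sin_coef b i : R :=
  nth 0 [:: 0; 2 + (-1) ^+ b; - (2 + (-1) ^+ b); 0] i.

Definition weight b u i : R :=
  4^-1 + 20^-1 * trigf (cos_coef b i) (sin_coef b i) u.

(** The coefficients of [cos u] and [sin u] are at most 2 and 3 in absolute value, so the factor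
    1/20 keeps the perturbation within 1/4. *)
Lemma weight_ge0 b u i : 0 <= weight b u i.
Proof.
have := cos_geN1 u; have := cos_le1 u; have := sin_geN1 u; have := sin_le1 u.
rewrite /weight /trigf /cos_coef /sin_coef.
move: (cos u) (sin u) => c s.
by case: i => [|[|[|[|i]]]]; case: b; rewrite /= ?nth_nil ?expr0 ?expr1; lra.
Qed.

(** The factor [1 - X] makes the coefficients of the perturbation add up to 0. *)
Lemma weight_sum1 b u : \sum_(i < 4) weight b u i = 1.
Proof.
rewrite !big_ord_recl big_ord0 /weight /trigf /cos_coef /sin_coef /=.
by field.
Qed.

Definition genfun b u : {poly R} := \sum_(i < 4) weight b u i *: 'X^i.

Lemma horner_genfun b u x : (genfun b u).[x] =
  4^-1 * (1 + x + x ^+ 2 + x ^+ 3) +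
  trigf (20^-1 * (1 - x) * (x ^+ 2 - 2 * (-1) ^+ b))
        (20^-1 * (1 - x) * ((2 + (-1) ^+ b) * x)) u.
Proof.
rewrite /genfun !big_ord_recl big_ord0 !hornerE.
rewrite /weight /trigf /cos_coef /sin_coef /=.
by ring.
Qed.

Let period : set mR := `[0, pi *+ 2]%classic.

Lemma continuous_weight b i : continuous (fun u => weight b u i).
Proof.
move=> u; apply: cvgD; first exact: cvg_cst.
by apply: cvgM; [exact: cvg_cst|exact: continuous_trigf].
Qed.

Lemma continuous_coef_genfunX b n k : continuous (fun u => (genfun b u ^+ n)`_k).
Proof.
rewrite (_ : (fun _ => _) = fun u =>
  \sum_(t : {ffun 'I_n -> 'I_4} | k == \sum_(j < n) (t j : nat))
     \prod_(j < n) weight b u (t j)); last first.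
  apply/funext => u.
  by rewrite /genfun (sum_genfunX (fun i : 'I_4 => weight b u i)).
apply: continuous_big => [|t _]; first exact: add_continuous.
apply: continuous_big => [|j _]; first exact: mul_continuous.
exact: continuous_weight.
Qed.

Lemma eq_poly_horner (p q : {poly R}) : (forall x, p.[x] = q.[x]) -> p = q.
Proof.
move=> pq; apply/eqP; rewrite -subr_eq0; apply/eqP.
pose N := size (p - q).
apply: (@roots_geq_poly_eq0 _ _ [seq i%:R | i <- iota 0 N]).
- by apply/allP => x _; rewrite /root !hornerE pq subrr.
- rewrite map_inj_uniq ?iota_uniq// => i j /eqP.
  by rewrite eqr_nat => /eqP.
- by rewrite size_map size_iota.
Qed.

(** The integrated coefficients are those of the polynomial whose value at [x] is the integral of
    [(genfun b u).[x] ^+ n], so it suffices to compare values at each real [x]. *)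
Lemma eq_Rintegral_coef_genfunX n k :
  \int[lebesgue_measure]_(u in period) (genfun true u ^+ n)`_k =
  \int[lebesgue_measure]_(u in period) (genfun false u ^+ n)`_k.
Proof.
pose J b k := \int[lebesgue_measure]_(u in period) (genfun b u ^+ n)`_k.
(* The first bound makes the truncated polynomial contain the coefficient of index [k], the second
   makes truncation lossless for a power of a cubic. *)
pose N := maxn k.+1 (3 * n).+1.
have sizeX b u : (size (genfun b u ^+ n) <= N)%N.
  rewrite leq_max; apply/orP; right.
  rewrite (leq_trans (size_poly_exp_leq _ _))//.
  rewrite ltnS leq_mul2r; apply/orP; right.
  have : (size (genfun b u) <= 4)%N.
    apply: (leq_trans (size_sum _ _ _)); apply/bigmax_leqP => i _.
    by rewrite (leq_trans (size_scale_leq _ _))// size_polyXn.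
  by case: (size _).
suff JJ : \poly_(i < N) J true i = \poly_(i < N) J false i.
  by move/polyP/(_ k) : JJ; rewrite !coef_poly leq_max ltnSn.
apply: eq_poly_horner => x; rewrite !horner_poly.
have JE b : \sum_(i < N) J b i * x ^+ i =
    \int[lebesgue_measure]_(u in period) ((genfun b u).[x] ^+ n).
  transitivity (\int[lebesgue_measure]_(u in period)
      (\sum_(i < N) (genfun b u ^+ n)`_i * x ^+ i)).
    rewrite Rintegral_period_sum; last first.
      by move=> i u; apply: cvgM; [exact: continuous_coef_genfunX|exact: cvg_cst].
    apply: eq_bigr => i _; rewrite RintegralZr//.
    by apply: continuous_period_integrable; exact: continuous_coef_genfunX.
  by apply: eq_Rintegral => u _; rewrite -horner_exp (@horner_coef_wide _ N).
rewrite !JE.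
have HE b u : (genfun b u).[x] ^+ n = _ :=
  congr1 (fun y => y ^+ n) (horner_genfun b u x).
under eq_Rintegral do rewrite HE; under [RHS]eq_Rintegral do rewrite HE.
(* For both values of [b] the squared amplitude is [(20^-1 * (1 - x)) ^+ 2 * (x ^+ 2 + 1) * (x ^+ 2
   + 4)]. *)
by apply: eq_Rintegral_trigX; rewrite /= !expr0 !expr1; ring.
Qed.

Definition theta_fam b u : probR R :=
  @nat_law R 4 (fun i => NngNum (weight_ge0 b u i)) (weight_sum1 b u).

Lemma theta_famE b u (A : set mR) :
  theta_fam b u A = (\sum_(i < 4) weight b u i * ((i%:R : R) \in A)%:R)%:E.
Proof. exact: nat_lawE. Qed.

Lemma theta_fam1 b u (i : 'I_4) :
  theta_fam b u [set (i%:R : R)] = (weight b u i)%:E.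
Proof. exact: (nat_law1 (c := fun i => NngNum (weight_ge0 b u i))). Qed.

Lemma measurable_theta_fam b :
  measurable_fun [set: mR] (theta_fam b : mR -> probR R).
Proof.
apply: (measurability (@pset _ mR R : set (set (probR R)))) => //.
move=> _ -[_ [r r01] [A mA <-]] <-; apply: emeasurable_fun_infty_o => //=.
rewrite (_ : (fun _ => _) = (fun u =>
    (\sum_(i < 4) weight b u i * ((i%:R : R) \in A)%:R)%:E)); last first.
  by apply/funext => u; exact: theta_famE.
apply/measurable_EFinP; apply: measurable_sum => i.
apply: measurable_funM => //.
by apply: continuous_measurable_fun; exact: continuous_weight.
Qed.

Let theta_mfun b : {mfun mR >-> probR R} :=
  HB.pack (theta_fam b : mR -> probR R)
    (isMeasurableFun.Build _ _ _ _ _ (measurable_theta_fam b)).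

Let period_gt0 : 0 < pi *+ 2 :> R. Proof. by rewrite mulrn_wgt0// pi_gt0. Qed.

Definition Theta b : probability (probR R) R :=
  distribution (uniform_prob period_gt0) (theta_mfun b).

Lemma Theta_Pplus b : concentrated_on (Theta b) (@Pplus R).
Proof.
rewrite /concentrated_on -(probability_setT (uniform_prob period_gt0)).
congr (uniform_prob _ _); apply/seteqP; split => // u _.
transitivity (\sum_(i < 4) weight b u i)%:E; last by rewrite weight_sum1.
rewrite [LHS](theta_famE b u); congr EFin; apply: eq_bigr => i _.
by rewrite mem_set ?mulr1//=.
Qed.

(** Mixing over the angle averages the generating functions, so [b] enters only through the
    integrals compared in [eq_Rintegral_coef_genfunX]. *)
Lemma partial_sum_law b d (T : measurableType d) (P : probability T R)
    (X : nat -> {RV P >-> mR}) (prodN : probR R -> probability (seqR R) R) n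
    (A : set mR) :
  (forall theta, is_infinite_product theta (prodN theta)) ->
  (forall B, measurable B -> measurable_fun [set: probR R] (prodN ^~ B)) ->
  (forall B : set (seqR R), measurable B ->
    P [set w | B (fun j => X j w)] = (\int[Theta b]_theta prodN theta B)%E) ->
  measurable A ->
  pushforward P (partial_sum X n) A =
  ((pi *+ 2)^-1 * \sum_(k < (n * 4).+1 | (k%:R : R) \in A)
     \int[lebesgue_measure]_(u in period) (genfun b u ^+ n)`_k)%:E.
Proof.
move=> prodP mprod PE mA.
have mS := measurable_sum_event n mA.
transitivity (P [set w | sum_event n A (fun j => X j w)]); first by [].
rewrite PE// ge0_integral_distribution//; last exact: mprod.
have gE u : (prodN (theta_fam b u) (sum_event n A) =
    (\sum_(k < (n * 4).+1 | (k%:R : R) \in A) (genfun b u ^+ n)`_k)%:E)%E.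
  exact: (sum_event_genfun n (prodP (theta_fam b u)) (theta_fam1 b u)
    (weight_sum1 b u) mA).
rewrite integral_uniform//; last first.
  apply: (measurableT_comp (mprod _ mS)); exact: measurable_theta_fam.
rewrite subr0 EFinM; congr (_ * _)%E.
under eq_integral do rewrite /= gE.
rewrite -Rintegral_period_sum; last by move=> k; exact: continuous_coef_genfunX.
rewrite /Rintegral fineK//; apply: integrable_fin_num => //.
apply: continuous_period_integrable.
apply: continuous_big => [|k _]; first exact: add_continuous.
exact: continuous_coef_genfunX.
Qed.

(* The coefficients of [cos u] in the weights of 0 and 3 have the same sign for
   [b = false] and opposite signs for [b = true]. *)
Definition small_ends : set (probR R) :=
  mset ([set (0%:R : R)] : set mR) 4^-1 `&`
  mset ([set (3%:R : R)] : set mR) 4^-1.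

Lemma measurable_small_ends : measurable small_ends.
Proof.
have mm (x : R) : measurable (mset ([set x] : set mR) 4^-1 : set (probR R)).
  apply: sub_sigma_algebra; exists 4^-1.
    by rewrite /= in_itv/=; apply/andP; split; lra.
  by exists [set x].
by apply: measurableI; exact: mm.
Qed.

(** The threshold is the constant part of each weight, so only the signs of the perturbations
    matter. *)
Lemma small_ends_theta b u : small_ends (theta_fam b u) =
  ((trigf (- 2 * (-1) ^+ b) 0 u < 0) /\ (trigf (- 1) 0 u < 0)).
Proof.
have h0 : theta_fam b u [set (0%:R : R)] = (weight b u 0)%:E.
  exact: (theta_fam1 b u (@Ordinal 4 0 isT)).
have h3 : theta_fam b u [set (3%:R : R)] = (weight b u 3)%:E.
  exact: (theta_fam1 b u (@Ordinal 4 3 isT)).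
transitivity ((theta_fam b u [set (0%:R : R)] < (4^-1)%:E)%E /\
  (theta_fam b u [set (3%:R : R)] < (4^-1)%:E)%E); first by [].
rewrite h0 h3.
rewrite !lte_fin /weight /cos_coef /sin_coef /=.
congr (_ /\ _); apply: congr1; apply/idP/idP; lra.
Qed.

(** Both conditions say that [cos u] is positive, which holds on the first quarter of the period. *)
Lemma Theta_small_ends_false : Theta false small_ends != 0%E.
Proof.
pose I : set mR := `]0, pi / 2[%classic.
have mI : measurable I by exact: measurable_itv.
have pi0 := pi_gt0 R.
rewrite gt_eqF// (@lt_le_trans _ _ (uniform_prob period_gt0 I))//.
  rewrite uniform_probE// (_ : I `&` _ = I).
    rewrite lebesgue_measure_itv/= lte_fin divr_gt0//= -EFinD -EFinM lte_fin.
    by rewrite !subr0 mulr_gt0 ?invr_gt0 ?divr_gt0.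
  apply/setIidPl => u; rewrite /I/= !in_itv/= => /andP[u0 u1].
  by rewrite u0/= mulr2n; lra.
rewrite le_measure ?inE//.
  rewrite -[X in measurable X]setTI.
  exact: measurable_theta_fam measurableT _ measurable_small_ends.
move=> u; rewrite /I/= in_itv/= => /andP[u0 u1].
have : 0 < cos u by rewrite cos_gt0_pihalf//; apply/andP; split => //; lra.
by rewrite /preimage/= small_ends_theta /trigf expr0; lra.
Qed.

(** The two conditions ask for opposite signs of [cos u], so no angle satisfies both. *)
Lemma Theta_small_ends_true : Theta true small_ends = 0%E.
Proof.
rewrite -[RHS](measure0 (uniform_prob period_gt0)); congr (uniform_prob _ _).
rewrite -subset0 => u; rewrite /preimage /= small_ends_theta /trigf expr1.
by move=> [c1 c2]; lra.
Qed.

End counterexample.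

Theorem proposition2p3p1 (R : realType) : ~ good (@Pplus R).
Proof.
move=> /(_ (Theta false) (Theta true)
  (Theta_Pplus false) (Theta_Pplus true)) H.
have [d1 [T1 [P1 [X [pX [prodX mX PX]]]]]] := iid_mixture_exists (@Theta R false).
have [d2 [T2 [P2 [Y [pY [prodY mY PY]]]]]] := iid_mixture_exists (@Theta R true).
have {}H : same_measure (@Theta R false) (@Theta R true).
  apply: (H d1 T1 P1 X d2 T2 P2 Y); [by exists pX|by exists pY|].
  move=> n _ A mA.
  rewrite (partial_sum_law n prodX mX PX mA) (partial_sum_law n prodY mY PY mA).
    by congr (_ * _)%:E; apply: eq_bigr => k _; rewrite eq_Rintegral_coef_genfunX.
have /eqP := @Theta_small_ends_false R; apply.
by rewrite H ?Theta_small_ends_true//; exact: measurable_small_ends.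
Qed.
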